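(* Let $n$ be a positive integer and let $\alpha\in\mathrm{wEnd}\,\vec{P}_n$. Then the following properties are equivalent: \begin{enumerate} \item $\alpha$ is a regular element of the monoid $\mathrm{wEnd}\,\vec{P}_n$; \item for all $x\in\mathrm{Im}(\alpha)$, $|x\alpha^{-1}|>1$ implies $x\alpha^{-1}\cap\{1,n\}\neq\emptyset$; \item for all $x\in\mathrm{Im}(\alpha)$, $|x\alpha^{-1}|>1$ implies $x\in\{\min\mathrm{Im}(\alpha),\max\mathrm{Im}(\alpha)\}$. \end{enumerate}
   Context: $\vec{P}_n$ denotes the directed path with vertex set $\{1,\ldots,n\}$ and edge set $E=\{(i,i+1) : i=1,\ldots,n-1\}$. A weak endomorphism of $\vec{P}_n$ is a map $\alpha:\{1,\ldots,n\}\to\{1,\ldots,n\}$ such that, for all vertices $u,v$, if $(u,v)\in E$ and $u\alpha\neq v\alpha$ then $(u\alpha,v\alpha)\in E$ (maps are written on the right of their arguments and composed left to right: $x(\alpha\beta)=(x\alpha)\beta$). $\mathrm{wEnd}\,\vec{P}_n$ denotes the monoid of all weak endomorphisms of $\vec{P}_n$ under composition. $\mathrm{Im}(\alpha)=\{x\alpha : x\in\{1,\ldots,n\}\}$ is the image of $\alpha$, and $x\alpha^{-1}=\{y\in\{1,\ldots,n\} : y\alpha=x\}$ is the preimage of $x$ under $\alpha$. An element $s$ of a semigroup $S$ is called regular if there exists $x\in S$ such that $s=sxs$. *)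

(* Defs.v *)
From HB Require Import structures.
From mathcomp Require Import all_boot.

Set Implicit Arguments.
Unset Strict Implicit.
Unset Printing Implicit Defensive.

Definition regular (S : semigroupType) (s : S) : Prop :=
  exists x : S, s = (s * x * s)%g.

Definition weak_endo (T : finType) (e : rel T) (f : {ffun T -> T}) : bool :=
  [forall u, forall v, e u v && (f u != f v) ==> e (f u) (f v)].

Record wEnd (T : finType) (e : rel T) :=
  WEnd { wend_fun :> {ffun T -> T}; wend_funP : weak_endo e wend_fun }.

HB.instance Definition _ (T : finType) (e : rel T) :=
  [isSub for @wend_fun T e].
HB.instance Definition _ (T : finType) (e : rel T) :=
  [Finite of wEnd e by <:].

Section WEndMonoid.
Variables (T : finType) (e : rel T).
Implicit Types f g h : wEnd e.

Lemma weak_endo_id : weak_endo e [ffun x => x].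
Proof.
apply/forallP=> u; apply/forallP=> v; rewrite !ffunE.
by apply/implyP=> /andP[].
Qed.

Lemma weak_endo_comp f g : weak_endo e [ffun x => g (f x)].
Proof.
apply/forallP=> u; apply/forallP=> v; rewrite !ffunE.
apply/implyP=> /andP[euv gfuv].
have fuv : f u != f v by apply: contra gfuv => /eqP->.
have /forallP/(_ u)/forallP/(_ v)/implyP := wend_funP f.
rewrite euv fuv => /(_ isT) efuv.
have /forallP/(_ (f u))/forallP/(_ (f v))/implyP := wend_funP g.
by rewrite efuv gfuv; apply.
Qed.

Definition wend_one : wEnd e := WEnd weak_endo_id.

(* Left-to-right composition: x (f * g) = (x f) g. *)
Definition wend_mul f g : wEnd e := WEnd (weak_endo_comp f g).

Lemma wend_mulA : associative wend_mul.
Proof. by move=> f g h; apply/val_inj/ffunP=> x; rewrite !ffunE. Qed.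

Lemma wend_1mul : left_id wend_one wend_mul.
Proof. by move=> f; apply/val_inj/ffunP=> x; rewrite !ffunE. Qed.

Lemma wend_mul1 : right_id wend_one wend_mul.
Proof. by move=> f; apply/val_inj/ffunP=> x; rewrite !ffunE. Qed.

HB.instance Definition _ :=
  isMonoid.Build (wEnd e) wend_mulA wend_1mul wend_mul1.

End WEndMonoid.

(* The vertices 1, ..., n are represented by the ordinals 0, ..., n - 1. *)
Definition dipath (n : nat) : rel 'I_n := fun i j => j == i.+1 :> nat.

(* The vertex set {1, n}, shifted to {0, n - 1}. *)
Definition endpoints (n : nat) : {set 'I_n} :=
  [set i : 'I_n | (i == 0 :> nat) || (i == n.-1 :> nat)].

Definition is_min (n : nat) (A : {set 'I_n}) (x : 'I_n) : Prop :=
  x \in A /\ forall y, y \in A -> x <= y.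

Definition is_max (n : nat) (A : {set 'I_n}) (x : 'I_n) : Prop :=
  x \in A /\ forall y, y \in A -> y <= x.

(* Main.v *)
Require Import Defs.
From mathcomp Require Import all_boot zify.

(** A weak endomorphism of the directed path raises its value by 0 or 1 at each
step, so it is nondecreasing and 1-Lipschitz ([wend_dipath_growth]); its
smallest and largest values are the ones at the two endpoints.  Hence a fibre
meets the endpoints exactly when it lies over the minimum or the maximum of the
image, which is (2) <-> (3).

For (1) -> (2), if [f = f g f] then [g] is a section of [f] over its image.
When the fibre over [x] avoids both endpoints, [x - 1] and [x + 1] are also
values of [f], and [g], having steps 0 or 1 and being injective on the image,
sends [x - 1, x, x + 1] to three consecutive vertices.  As [f] is nondecreasing
and has the values [x - 1] and [x + 1] at the outer two, the fibre over [x] is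
reduced to the middle one ([regular_fibre_endpoints]).

For (2) -> (1), let [a] and [b] be the extreme values of [f], and let [i] be the
last vertex with value [a].  After [i] the map cannot pause at a value strictly
between [a] and [b], so it climbs from [a] to [b] one unit at each step
([wend_dipath_climb]).  Reading this climb backwards and extending it by
constants on both sides gives a weak endomorphism [g] with [f = f g f]
([fibre_endpoints_regular]). *)

Set Implicit Arguments.
Unset Strict Implicit.
Unset Printing Implicit Defensive.

Lemma weak_endo_dipathP n (f : {ffun 'I_n -> 'I_n}) :
  reflect (forall i j : 'I_n, j = i.+1 :> nat -> f i <= f j <= (f i).+1)
          (weak_endo (@dipath n) f).
Proof.
apply: (iffP forallP) => [H i j ij | H i].
  have /forallP/(_ j)/implyP := H i; rewrite /dipath ij eqxx /=.
  case: (eqVneq (f i) (f j)) => [-> _|_ /(_ isT)/eqP ->]; lia.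
apply/forallP => j; apply/implyP => /andP[/eqP ij]; rewrite -val_eqE /dipath /=.
move: (H i j ij); lia.
Qed.

(** Summing the steps, each of which is 0 or 1, from [i] to [j]. *)
Lemma wend_dipath_growth n (f : wEnd (@dipath n)) (i j : 'I_n) :
  i <= j -> f i <= f j <= f i + (j - i).
Proof.
have /weak_endo_dipathP step := wend_funP f.
case: j => j; elim: j => [|j IH] jn /= ij.
  have -> : i = Ordinal jn by apply: val_inj => /=; lia.
  lia.
have [ij'|ij'] := leqP i j; last first.
  have -> : i = Ordinal jn by apply: val_inj => /=; lia.
  lia.
have /= := IH (ltnW jn) ij'.
have /= := step (Ordinal (ltnW jn)) (Ordinal jn) erefl; lia.
Qed.

(** A fibre away from the endpoints lies over an interior value [x].  A section
[g] of [f] with steps 0 or 1 then goes through consecutive vertices over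
[x - 1], [x], [x + 1], and monotonicity of [f] leaves room for one preimage of
[x] only. *)
Lemma regular_fibre_endpoints n (f : wEnd (@dipath n)) (x : 'I_n) :
  regular f -> 1 < #|[set y | f y == x]| ->
  [set y | f y == x] :&: endpoints n != set0.
Proof.
move=> [g fgf]; apply: contraTN => /eqP fib0; rewrite -leqNgt.
have fgfE y : f (g (f y)) = f y.
  by rewrite [in RHS]fgf !ffunE.
have notend (y : 'I_n) : f y = x -> 0 < y < n.-1.
  move=> fy; move/setP/(_ y): fib0; rewrite !inE fy eqxx /=.
  move: (ltn_ord y); lia.
have [->|[y0]] := set_0Vmem [set y | f y == x]; first by rewrite cards0.
rewrite inE => fy0.
have /weak_endo_dipathP step := wend_funP f.
have /weak_endo_dipathP stepg := wend_funP g.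
(* The neighbours of the first and last vertices of the fibre show that [x - 1]
   and [x + 1] are values of [f]. *)
have [u /eqP fu minu] := @arg_minnP _ y0 (fun y => f y == x) (fun y => y : nat) fy0.
have [v /eqP fv maxv] := @arg_maxnP _ y0 (fun y => f y == x) (fun y => y : nat) fy0.
have /andP[u0 _] := notend _ fu; have /andP[_ vn] := notend _ fv.
have u'n : u.-1 < n by move: (ltn_ord u); lia.
have v'n : v.+1 < n by lia.
have fu' : (f (Ordinal u'n)).+1 = x.
  have := step (Ordinal u'n) u; rewrite /= fu => /(_ ltac:(lia)).
  case: (eqVneq (f (Ordinal u'n)) x) => [fx|].
    by have /= := minu (Ordinal u'n); rewrite fx eqxx => /(_ isT); lia.
  by rewrite -val_eqE /=; lia.
have fv' : f (Ordinal v'n) = x.+1 :> nat.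
  have := step v (Ordinal v'n); rewrite /= fv => /(_ erefl).
  case: (eqVneq (f (Ordinal v'n)) x) => [fx|].
    by have /= := maxv (Ordinal v'n); rewrite fx eqxx => /(_ isT); lia.
  by rewrite -val_eqE /=; lia.
set x' := f (Ordinal u'n) in fu'; set x'' := f (Ordinal v'n) in fv'.
have fgx' : f (g x') = x' by apply: fgfE.
have fgx'' : f (g x'') = x'' by apply: fgfE.
have fgx : f (g x) = x by rewrite -fu fgfE.
have gx : g x = (g x').+1 :> nat.
  have := stepg x' x (esym fu'); case: (eqVneq (g x') (g x)) => [gE|].
    by move: fgx'; rewrite gE fgx => xE; move: fu'; rewrite -xE; lia.
  by rewrite -val_eqE /=; lia.
have gx'' : g x'' = (g x).+1 :> nat.
  have := stepg x x'' fv'; case: (eqVneq (g x) (g x'')) => [gE|].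
    by move: fgx''; rewrite -gE fgx => xE; move: fv'; rewrite -xE; lia.
  by rewrite -val_eqE /=; lia.
rewrite -(cards1 (g x)); apply/subset_leq_card/subsetP => y; rewrite !inE.
move=> /eqP fy; rewrite -val_eqE eqn_leq /=; apply/andP; split; rewrite leqNgt;
  apply/negP => lt.
  have le : g x'' <= y by rewrite gx''.
  have /andP[+ _] := wend_dipath_growth f le.
  by rewrite fgx'' fy fv' ltnn.
have le : y <= g x' by rewrite -ltnS -gx.
have /andP[+ _] := wend_dipath_growth f le.
by rewrite fgx' fy -fu' ltnn.
Qed.

(** Take for [i] the last vertex where [f] has its least value.  From there on a
pause of [f] below its greatest value would create a fibre with two elements
over a value that is not extreme.  The climb fits inside the path, because the
last vertex has the greatest value and so is not met before the climb ends. *)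
Lemma wend_dipath_climb m (f : wEnd (@dipath m.+1)) :
    (forall x, 1 < #|[set y | f y == x]| ->
       f ord0 = x \/ f ord_max = x) ->
  exists i, forall k, k <= f ord_max - f ord0 ->
    i + k <= m /\ f (inord (i + k)) = f ord0 + k :> nat.
Proof.
move=> fib; have /weak_endo_dipathP step := wend_funP f.
have [i /eqP fi maxi] :=
  @arg_maxnP _ ord0 (fun y => f y == f ord0) (fun y => y : nat) (eqxx _).
exists i; elim=> [|k IH] kb.
  by rewrite !addn0 inord_val fi; split=> //; rewrite -ltnS.
have [ikm fik] := IH (ltnW kb).
have ik_lt : i + k < m.
  rewrite ltn_neqAle ikm andbT; apply/eqP => ikE.
  have E : inord (i + k) = ord_max :> 'I_m.+1.
    by apply: val_inj; rewrite /= inordK ?ikE.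
  by move: fik; rewrite E; lia.
split; first lia.
have iS : (inord (i + k.+1) : 'I_m.+1) = (inord (i + k) : 'I_m.+1).+1 :> nat.
  by rewrite !inordK; lia.
have stepk := step _ _ iS.
(* If [f] pauses after [i + k], the value there has two preimages; it cannot be
   the largest value, and it is not the smallest one by the choice of [i]. *)
have [/val_inj fE|ne] :=
    eqVneq (f (inord (i + k.+1)) : nat) (f (inord (i + k))).
  have : 1 < #|[set y | f y == f (inord (i + k))]|.
    apply/card_gt1P; exists (inord (i + k)), (inord (i + k.+1)).
    by rewrite !inE fE eqxx; split=> //; rewrite -val_eqE /= iS; lia.
  case/fib => [f0|fmax].
    have := maxi (inord (i + k.+1)); rewrite fE f0 eqxx => /(_ isT).
    by rewrite inordK; lia.
  by move: fik; rewrite -fmax; lia.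
by move: fik stepk ne => /=; lia.
Qed.

(** The partial inverse of [f] sends [f ord0 + k] to the vertex [i + k] of the
climb; truncated subtraction and [minn] make it constant below and above the
image of [f], which keeps its steps equal to 0 or 1. *)
Lemma fibre_endpoints_regular m (f : wEnd (@dipath m.+1)) :
    (forall x, 1 < #|[set y | f y == x]| ->
       f ord0 = x \/ f ord_max = x) ->
  regular f.
Proof.
case/wend_dipath_climb => i climb.
pose d := f ord_max - f ord0.
pose g := [ffun y : 'I_m.+1 => inord (i + minn (y - f ord0) d) : 'I_m.+1].
have gE y : g y = i + minn (y - f ord0) d :> nat.
  by rewrite ffunE inordK // ltnS (climb _ (geq_minr _ _)).1.
have gP : weak_endo (@dipath m.+1) g.
  by apply/weak_endo_dipathP => u v uv; rewrite !gE uv; lia.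
exists (WEnd gP); apply/val_inj/ffunP => y; rewrite !ffunE.
apply/val_inj; rewrite /= (climb _ (geq_minr _ _)).2.
have := @wend_dipath_growth _ f ord0 y (leq0n _).
have := @wend_dipath_growth _ f y ord_max (leq_ord _).
rewrite /d /=; lia.
Qed.

Theorem proposition1p7 (n : nat) (n_gt0 : 0 < n) (alpha : wEnd (@dipath n)) :
  let im : {set 'I_n} := [set alpha x | x : 'I_n] in
  let preim (x : 'I_n) : {set 'I_n} := [set y | alpha y == x] in
  let P1 := regular alpha in
  let P2 := forall x : 'I_n, x \in im -> 1 < #|preim x| ->
    preim x :&: endpoints n != set0 in
  let P3 := forall x : 'I_n, x \in im -> 1 < #|preim x| ->
    is_min im x \/ is_max im x in
  (P1 <-> P2) /\ (P2 <-> P3).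
Proof.
case: n n_gt0 alpha => // m _ f im preim P1 P2 P3.
have preim_endpoints x :
    preim x :&: endpoints m.+1 != set0 <-> f ord0 = x \/ f ord_max = x.
  split=> [/set0Pn[y] | [] fx].
  - rewrite !inE => /andP[/eqP fy /orP[]/eqP yE]; [left | right];
      by rewrite -fy; congr (f _); apply: val_inj.
  - by apply/set0Pn; exists ord0; rewrite !inE fx eqxx.
  - by apply/set0Pn; exists ord_max; rewrite !inE fx !eqxx orbT.
have im_min x : is_min im x <-> f ord0 = x.
  split=> [[/imsetP[y _ ->] ymin] | <-].
    apply/val_inj/eqP; rewrite eqn_leq ymin ?imset_f // andbT.
    by have /andP[] := @wend_dipath_growth _ f ord0 y (leq0n _).
  split=> [|_ /imsetP[y _ ->]]; first exact: imset_f.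
  by have /andP[] := @wend_dipath_growth _ f ord0 y (leq0n _).
have im_max x : is_max im x <-> f ord_max = x.
  split=> [[/imsetP[y _ ->] ymax] | <-].
    apply/val_inj/eqP; rewrite eqn_leq ymax ?imset_f //=.
    by have /andP[] := @wend_dipath_growth _ f y ord_max (leq_ord _).
  split=> [|_ /imsetP[y _ ->]]; first exact: imset_f.
  by have /andP[] := @wend_dipath_growth _ f y ord_max (leq_ord _).
split; split.
- by move=> reg x _; apply: regular_fibre_endpoints.
- move=> fib; apply: fibre_endpoints_regular => x xfib.
  apply/preim_endpoints/fib => //.
  have /card_gt0P[y] := ltnW xfib.
  by rewrite inE => /eqP <-; apply: imset_f.
- by move=> fib x xim /(fib x xim)/preim_endpoints; rewrite im_min im_max.
- move=> ext x xim /(ext x xim); rewrite im_min im_max => fx.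
  exact/preim_endpoints.
Qed.
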